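(* The mapping $\mathfrak f:(\tilde x,\tilde n,\tilde{\mathfrak p})\rightarrow(x,n,\mathfrak p)$ given, for $k=1,2,\dots,p$, by $$x_k=\tilde n_{p+1-k},\qquad n_k=\tilde x_{p+1-k},\qquad \mathfrak p_k=\frac{\tilde{\mathfrak p}_{p+1-k}\,(1-|\tilde{\mathfrak p}|)}{(1-\tilde{\mathfrak P}_1^{p+1-k})(1-\tilde{\mathfrak P}_1^{p-k})}$$ is a bijection $\mathbb{R}^{3p}\rightarrow\mathbb{R}^{3p}$ such that $\mathfrak f^{-1}=\mathfrak f$. Moreover, if $(x,n,\mathfrak p)=\mathfrak f(\tilde x,\tilde n,\tilde{\mathfrak p})$ and $n,\tilde n\in\mathbb{N}_0^p$, then the multivariable Krawtchouk polynomials satisfy the duality relation $$K_p(n;x;\mathfrak p;N)=K_p(\tilde n;\tilde x;\tilde{\mathfrak p};N).$$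
   Context: Notation: $p\ge1$ is an integer; $x,n,\mathfrak p$ and $\tilde x,\tilde n,\tilde{\mathfrak p}$ are $p$-component vectors, with $\mathfrak p=(\mathfrak p_1,\dots,\mathfrak p_p)$ and a further parameter $N$. For a vector $v$ with $p$ components, $|v|=v_1+\cdots+v_p$. Partial sums are written $\mathfrak P_1^j=\mathfrak p_1+\cdots+\mathfrak p_j$, $\tilde{\mathfrak P}_1^j=\tilde{\mathfrak p}_1+\cdots+\tilde{\mathfrak p}_j$, $X_1^j=x_1+\cdots+x_j$, $N_1^j=n_1+\cdots+n_j$, with value $0$ for $j=0$. Also $(a)_k=a(a+1)\cdots(a+k-1)$, $(a)_0=1$. One-dimensional Krawtchouk polynomials, for $n\in\mathbb{N}_0$ and $x,\mathfrak p,N\in\mathbb{R}$: $$k_n(x;\mathfrak p;N)=(-N)_n\;{}_2F_1\!\left[\begin{matrix}-n,\ -x\\ -N\end{matrix};\frac1{\mathfrak p}\right].$$ Multivariable Krawtchouk polynomials, for $n\in\mathbb{N}_0^p$ and parameters $\mathfrak p=(\mathfrak p_1,\dots,\mathfrak p_p)$ and $N$: $$K_p(n;x;\mathfrak p;N)=\frac1{(-N)_{|n|}}\prod_{j=1}^p k_{n_j}\!\left(x_j;\frac{\mathfrak p_j}{1-\mathfrak P_1^{j-1}};N-|n|+N_1^j-X_1^{j-1}\right).$$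
   Formalization: The map is a bijection of the set where all 1-P̃_1^j (j=1..p) are nonzero, not of all R^{3p}, where it is undefined (e.g. p̃_1=1); duality is stated there, with p̃_j, (-N)_{|n|}, (-N)_{|ñ|} nonzero, and k_n is read as a polynomial in N. *)

(* Defs.v *)
From HB Require Import structures.
From mathcomp Require Import all_boot all_order all_algebra.
From mathcomp Require Import all_classical reals ring.

Set Implicit Arguments.
Unset Strict Implicit.
Unset Printing Implicit Defensive.

Import Order.TTheory GRing.Theory Num.Theory.
Local Open Scope ring_scope.

(* v_1 + ... + v_j; component v_i is [v 0 (i-1)], as 'I_p is 0-based.  Used
   both for real vectors and for vectors of natural numbers. *)
Definition psum (V : nmodType) (p : nat) (v : 'rV[V]_p) (j : nat) : V :=
  \sum_(i < p | (i < j)%N) v 0 i.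

Definition vsum (V : nmodType) (p : nat) (v : 'rV[V]_p) : V :=
  \sum_(i < p) v 0 i.

Definition poch (R : realType) (a : R) (k : nat) : R :=
  \prod_(i < k) (a + i%:R).

(* The terminating series 2F1[-n, b; c; z]. *)
Definition hyp2F1 (R : realType) (n : nat) (b c z : R) : R :=
  \sum_(k < n.+1)
    poch (- n%:R) k * poch b k / (poch c k * k`!%:R) * z ^+ k.

(* (-N)_n 2F1[-n, -x; -N; 1/q], with (-N)_n / (-N)_k = (k-N)_(n-k) cancelled
   in each term: this is what makes it a polynomial in N, defined also when
   N is one of 0, 1, ..., n-1 (see [krawtchoukE] for the other values). *)
Definition krawtchouk (R : realType) (n : nat) (x q N : R) : R :=
  \sum_(k < n.+1)
    poch (- n%:R) k * poch (- x) k / k`!%:R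
      * poch (k%:R - N) (n - k) * q^-1 ^+ k.

Lemma poch_split (R : realType) (a : R) (k n : nat) :
  (k <= n)%N -> poch a n = poch a k * poch (k%:R + a) (n - k).
Proof.
move=> /subnKC <-; rewrite addKn /poch big_split_ord /=.
congr (_ * _); apply: eq_bigr => i _.
by rewrite natrD addrCA addrA.
Qed.

Lemma krawtchoukE (R : realType) (n : nat) (x q N : R) :
  poch (- N) n != 0 ->
  krawtchouk n x q N = poch (- N) n * hyp2F1 n (- x) (- N) q^-1.
Proof.
move=> nz; rewrite /krawtchouk /hyp2F1 big_distrr /=.
apply: eq_bigr => k _; have lekn : (k <= n)%N by rewrite -ltnS.
move: nz; rewrite (poch_split _ lekn) mulf_eq0 negb_or => /andP[nzk _].
by field; rewrite nzk pnatr_eq0 -lt0n fact_gt0.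
Qed.

(* The factor indexed by i : 'I_p is the one for j = i + 1. *)
Definition mkrawtchouk (R : realType) (p : nat) (n : 'rV[nat]_p)
    (x q : 'rV[R]_p) (N : R) : R :=
  (poch (- N) (vsum n))^-1 *
  \prod_(i < p)
    krawtchouk (n 0 i) (x 0 i) (q 0 i / (1 - psum q i))
      (N - (vsum n)%:R + (psum n i.+1)%:R - psum x i).

(* For k = i + 1, index p + 1 - k is 0-based [rev_ord i] = p - k. *)
Definition dual_param (R : realType) (p : nat) (q : 'rV[R]_p) : 'rV[R]_p :=
  \row_(i < p)
    (q 0 (rev_ord i) * (1 - vsum q)
     / ((1 - psum q (rev_ord i).+1) * (1 - psum q (rev_ord i)))).

Definition rev_row (V : Type) (p : nat) (v : 'rV[V]_p) : 'rV[V]_p :=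
  \row_(i < p) v 0 (rev_ord i).

Definition dual_map (R : realType) (p : nat)
    (t : 'rV[R]_p * 'rV[R]_p * 'rV[R]_p) : 'rV[R]_p * 'rV[R]_p * 'rV[R]_p :=
  let: (x, n, q) := t in (rev_row n, rev_row x, dual_param q).

(* The points of R^(3p) at which no denominator in [dual_map] vanishes. *)
Definition dual_dom (R : realType) (p : nat) :
    set ('rV[R]_p * 'rV[R]_p * 'rV[R]_p) :=
  [set t | forall j : nat, (1 <= j <= p)%N -> 1 - psum t.2 j != 0]%classic.

Definition natrow (R : realType) (p : nat) (m : 'rV[nat]_p) : 'rV[R]_p :=
  map_mx (fun k : nat => k%:R) m.

(* Main.v *)
Require Import Defs.
From HB Require Import structures.
From mathcomp Require Import all_boot all_order all_algebra.
From mathcomp Require Import all_classical reals.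
From mathcomp Require Import ring zify.

Set Implicit Arguments.
Unset Strict Implicit.
Unset Printing Implicit Defensive.

Import Order.TTheory GRing.Theory Num.Theory.
Local Open Scope ring_scope.

(** Why the theorem is true.  Put [y = rev_row mt], so that [x = y] and
    [xt = rev_row m] as real vectors.  The duality holds factor by factor: the
    factor of the left-hand side at [i] and the factor of the right-hand side
    at [rev_ord i] are the one-dimensional polynomials k_n(y; r; M) and
    k_y(n; r; M), with n = m_i, y = y_i and with the same r and M.  Indeed M is
    N - B on both sides, where B is the sum of the y_l with l < i and of the
    m_l with i < l, and r agrees by [dual_param_ratio].  One-dimensional
    Krawtchouk polynomials are self-dual up to normalization,
    (-M)_y k_n(y; r; M) = (-M)_n k_y(n; r; M) ([krawtchouk_dual]), because
    every term of the hypergeometric sum is symmetric in (n, y).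

    It remains to compare the normalizations.  Let A_i be the sum of the y_l
    with l < i and of the m_l with i <= l.  Multiplied by (-N)_B, the
    one-dimensional duality relates the factors through the two consecutive
    values (-N)_{A_i} and (-N)_{A_(i+1)}, so the whole product telescopes from
    A_0 = |m| to A_p = |y| ([prod_telescope]).  No division occurs, so that it
    does not matter that intermediate (-N)_{A_i} may vanish even though
    (-N)_{|m|} and (-N)_{|mt|} do not.

    The statements on the map all come from one telescoping sum: q_i is
    (1 - |qt|) times the difference of the reciprocals of two consecutive
    1 - psum qt j, whence 1 - psum q j = (1 - |qt|) / (1 - psum qt (p - j))
    ([dual_param_psum]). *)

(** * Partial sums and reversal *)

Lemma psum0 (V : nmodType) p (v : 'rV[V]_p) : psum v 0 = 0.
Proof. by rewrite /psum big_pred0. Qed.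

Lemma psum_full (V : nmodType) p (v : 'rV[V]_p) : psum v p = vsum v.
Proof. by apply: eq_bigl => i; rewrite ltn_ord. Qed.

Lemma psumS (V : nmodType) p (v : 'rV[V]_p) (i : 'I_p) :
  psum v i.+1 = psum v i + v 0 i.
Proof.
rewrite /psum (bigD1 i) //= addrC; congr (_ + _); apply: eq_bigl => l.
by rewrite ltnS andbC ltn_neqAle.
Qed.

Lemma rev_rowK (V : Type) p : involutive (@rev_row V p).
Proof. by move=> v; apply/rowP => i; rewrite !mxE rev_ordK. Qed.

Lemma psum_rev_row (V : nmodType) p (v : 'rV[V]_p) j : (j <= p)%N ->
  psum v j + psum (rev_row v) (p - j) = vsum v.
Proof.
move=> lejp; rewrite /vsum (bigID (fun i : 'I_p => (i < j)%N)) /=.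
congr (_ + _); rewrite /psum (reindex_inj rev_ord_inj) /=.
apply: eq_big => [i|i _]; last by rewrite mxE rev_ordK.
by have := ltn_ord i; lia.
Qed.

Lemma vsum_rev_row (V : nmodType) p (v : 'rV[V]_p) :
  vsum (rev_row v) = vsum v.
Proof. by rewrite -(psum_rev_row v (leq0n p)) psum0 add0r subn0 psum_full. Qed.

Lemma rev_row_natrow (R : realType) p (m : 'rV[nat]_p) :
  rev_row (natrow R m) = natrow R (rev_row m).
Proof. by apply/rowP => i; rewrite !mxE. Qed.

Lemma psum_natrow (R : realType) p (m : 'rV[nat]_p) j :
  psum (natrow R m) j = (psum m j)%:R.
Proof. by rewrite /psum raddf_sum; apply: eq_bigr => i _; rewrite mxE. Qed.

(** * The parameter map *)

Section DualParam.

Variables (R : realType) (p : nat) (q : 'rV[R]_p).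
Hypothesis q_dom : forall j : nat, (1 <= j <= p)%N -> 1 - psum q j != 0.

Lemma psum_dom j : (j <= p)%N -> 1 - psum q j != 0.
Proof.
by case: j => [_|j lejp]; [rewrite psum0 subr0 oner_neq0 | rewrite q_dom].
Qed.

Lemma vsum_dom : 1 - vsum q != 0.
Proof. by rewrite -psum_full psum_dom. Qed.

(** Each component of [dual_param q] is a difference of consecutive values of
    the right-hand side, by partial fractions. *)
Lemma dual_param_psum j : (j <= p)%N ->
  1 - psum (dual_param q) j = (1 - vsum q) / (1 - psum q (p - j)).
Proof.
elim: j => [_|j IHj ltjp].
  by rewrite psum0 subn0 psum_full subr0 divff // vsum_dom.
have -> := psumS (dual_param q) (Ordinal ltjp).
rewrite opprD addrA IHj 1?ltnW // mxE.
set i := rev_ord (Ordinal ltjp).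
have -> : (p - j)%N = i.+1 by rewrite /i /=; lia.
rewrite -[(p - j.+1)%N]/(val i).
have := psum_dom (ltnW (ltn_ord i)); have := psum_dom (ltn_ord i).
rewrite psumS => nzS nz.
by field; rewrite nz opprD addrA in nzS *; rewrite nzS.
Qed.

Lemma dual_param_dom j : (j <= p)%N -> 1 - psum (dual_param q) j != 0.
Proof.
move=> lejp; rewrite dual_param_psum //.
by rewrite mulf_neq0 ?invr_eq0 ?psum_dom ?vsum_dom ?leq_subr.
Qed.

(** The parameters of the one-dimensional factors are merely reversed. *)
Lemma dual_param_ratio (i : 'I_p) :
  dual_param q 0 i / (1 - psum (dual_param q) i)
    = q 0 (rev_ord i) / (1 - psum q (rev_ord i)).
Proof.
rewrite dual_param_psum 1?ltnW // mxE.
have -> : (p - i)%N = (rev_ord i).+1 by rewrite /=; have := ltn_ord i; lia.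
have := psum_dom (ltnW (ltn_ord (rev_ord i))).
have := psum_dom (ltn_ord (rev_ord i)); have := vsum_dom.
by move=> nzv nzS nz; field; rewrite nz nzS nzv.
Qed.

Lemma dual_paramK : dual_param (dual_param q) = q.
Proof.
apply/rowP => i; rewrite mxE -psum_full mxE rev_ordK.
rewrite !dual_param_psum ?leq_subr ?ltn_ord //= subnn psum0.
have -> : (p - (p - i.+1).+1)%N = i by have := ltn_ord i; lia.
have -> : (p - (p - i.+1))%N = i.+1 by have := ltn_ord i; lia.
have := psum_dom (ltnW (ltn_ord i)); have := psum_dom (ltn_ord i).
by have := vsum_dom => nzv nzS nz; field; rewrite nz nzS nzv.
Qed.

End DualParam.

Lemma dual_map_dom (R : realType) p (t : 'rV[R]_p * 'rV[R]_p * 'rV[R]_p) :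
  dual_dom t -> dual_dom (dual_map t).
Proof.
by case: t => [[x n] q] q_dom j /andP[_ lejp]; apply: dual_param_dom.
Qed.

Lemma dual_mapK (R : realType) p (t : 'rV[R]_p * 'rV[R]_p * 'rV[R]_p) :
  dual_dom t -> dual_map (dual_map t) = t.
Proof.
by case: t => [[x n] q] q_dom /=; rewrite !rev_rowK dual_paramK.
Qed.

Lemma dual_map_bij (R : realType) p :
  set_bij (@dual_dom R p) (@dual_dom R p) (@dual_map R p).
Proof.
split=> [t|t u|t] => [|/set_mem dt /set_mem du eqtu|dt].
- exact: dual_map_dom.
- by rewrite -(dual_mapK dt) eqtu dual_mapK.
- by exists (dual_map t); [apply: dual_map_dom | apply: dual_mapK].
Qed.

(** * One-dimensional duality *)

Lemma poch_oppn_eq0 (R : realType) n k :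
  (n < k)%N -> poch (- n%:R : R) k = 0.
Proof.
by move=> ltnk; rewrite /poch (bigD1 (Ordinal ltnk)) //= addNr mul0r.
Qed.

(** For k <= min(n, y) the left-hand normalization splits as
    (-M)_y = (-M)_k (k - M)_(y - k), which makes each term symmetric in (n, y);
    the terms with k > min(n, y) vanish. *)
Lemma krawtchouk_dual (R : realType) (n y : nat) (r M : R) :
  poch (- M) y * krawtchouk n y%:R r M = poch (- M) n * krawtchouk y n%:R r M.
Proof.
wlog leny : n y / (n <= y)%N => [IH|].
  by case: (leqP n y) => [/IH //|/ltnW /IH ->].
rewrite /krawtchouk [in RHS](bigID (fun k : 'I_y.+1 => (k < n.+1)%N)) /=.
rewrite [X in _ = _ * (_ + X)]big1 => [|k].
  rewrite addr0 -(big_ord_widen y.+1 (fun k =>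
    poch (- y%:R) k * poch (- n%:R) k / k`!%:R * poch (k%:R - M) (y - k)
      * r^-1 ^+ k)) // !big_distrr /=; apply: eq_bigr => k _.
  have lekn : (k <= n)%N by rewrite -ltnS.
  by rewrite (poch_split _ lekn) (poch_split _ (leq_trans lekn leny)); ring.
by rewrite -leqNgt => ltnk; rewrite (poch_oppn_eq0 _ ltnk) mulr0 !mul0r.
Qed.

(** * Telescoping the normalizations *)

(** Formally the product of the ratios [g i / f i] is [a p / a 0]; this form
    needs none of the [a i] to be invertible. *)
Lemma prod_telescope (R : comPzRingType) p (a : nat -> R) (f g : 'I_p -> R) :
  (forall i : 'I_p, a i.+1 * f i = a i * g i) ->
  a p * \prod_(i < p) f i = a 0 * \prod_(i < p) g i.
Proof.
elim: p f g => [|p IHp] f g fg; first by rewrite !big_ord0.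
rewrite !big_ord_recr /= mulrCA (fg ord_max) mulrCA !mulrA /=.
rewrite (IHp _ (fun i => g (widen_ord (leqnSn p) i))) // => i.
exact: fg (widen_ord (leqnSn p) i).
Qed.

(** The integer [B] is B_i of the introduction, and [B + y 0 i] and
    [B + m 0 i] are A_(i+1) and A_i. *)
Lemma mkrawtchouk_prod_dual (R : realType) p (m y : 'rV[nat]_p)
    (r : 'I_p -> R) (N : R) :
  let M i := N - (psum y i + psum (rev_row m) (p - i.+1))%:R in
  poch (- N) (vsum y) * \prod_(i < p) krawtchouk (m 0 i) (y 0 i)%:R (r i) (M i)
  = poch (- N) (vsum m) *
      \prod_(i < p) krawtchouk (y 0 i) (m 0 i)%:R (r i) (M i).
Proof.
move=> M; pose A j := (psum y j + psum (rev_row m) (p - j))%N.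
have -> : vsum y = A p by rewrite /A subnn psum0 addn0 psum_full.
have -> : vsum m = A 0 by rewrite /A subn0 psum0 psum_full vsum_rev_row.
apply: (@prod_telescope _ _ (fun j => poch (- N) (A j))) => i.
set B := (psum y i + psum (rev_row m) (p - i.+1))%N.
have -> : A i.+1 = (B + y 0%R i)%N by rewrite /A psumS /B addnAC.
have -> : A i = (B + m 0%R i)%N.
  have -> : A i = (psum y i + psum (rev_row m) (rev_ord i).+1)%N.
    by rewrite /A subnSK.
  by rewrite psumS mxE rev_ordK /B addnA.
rewrite !(@poch_split _ _ B (B + _)) ?leq_addr // !addKn.
have -> : B%:R - N = - M i by rewrite /M opprB.
by rewrite -!mulrA krawtchouk_dual.
Qed.

Theorem theorem5p6 (R : realType) (p : nat) (hp : (1 <= p)%N) :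
  (set_bij (@dual_dom R p) (@dual_dom R p) (@dual_map R p) /\
   (forall t : 'rV[R]_p * 'rV[R]_p * 'rV[R]_p,
      dual_dom t -> dual_map (dual_map t) = t)) /\
  (forall (xt nt qt x n q : 'rV[R]_p) (mt m : 'rV[nat]_p) (N : R),
     dual_dom (xt, nt, qt) ->
     (x, n, q) = dual_map (xt, nt, qt) ->
     n = natrow R m -> nt = natrow R mt ->
     (forall j : 'I_p, qt 0 j != 0) ->
     poch (- N) (vsum m) != 0 -> poch (- N) (vsum mt) != 0 ->
     mkrawtchouk m x q N = mkrawtchouk mt xt qt N).
Proof.
split; first by split; [apply: dual_map_bij | apply: dual_mapK].
move=> xt nt qt x n q mt m N qt_dom [-> nE ->] nm ntE _ nzm nzmt.
pose y := rev_row mt.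
have mtE : mt = rev_row y by rewrite rev_rowK.
have -> : xt = natrow R (rev_row m).
  by rewrite -rev_row_natrow -nm nE rev_rowK.
rewrite ntE rev_row_natrow -/y mtE {}/mkrawtchouk vsum_rev_row.
rewrite mtE vsum_rev_row in nzmt.
rewrite [in RHS](reindex_inj rev_ord_inj) /=.
apply: (mulfI nzm); apply: (mulfI nzmt).
rewrite mulVKf // [RHS]mulrCA mulVKf //.
pose r i := qt 0 (rev_ord i) / (1 - psum qt (rev_ord i)).
apply: (etrans _ (etrans (mkrawtchouk_prod_dual m y r N) _));
  congr (_ * _); apply: eq_bigr => i _.
  rewrite dual_param_ratio // mxE psum_natrow; congr krawtchouk.
  by rewrite -(psum_rev_row m (ltn_ord i)) !natrD; ring.
rewrite !mxE !rev_ordK psum_natrow subnSK //; congr krawtchouk.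
by rewrite -(psum_rev_row y (ltnW (ltn_ord i))) !natrD; ring.
Qed.
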